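(* Let $\mathscr{H}$ be the family of subgroups $H$ of $\mathbb{T}^{\mathbb{N}}$ which are weakly controllable in $\mathbb{T}^{\mathbb{N}}$ but not controllable in $\mathbb{T}^{\mathbb{N}}$. Then $|\mathscr{H}|=2^{\mathfrak{c}}$.
   Context: $\mathbb{T}$ is the circle group with its usual compact topology, $\mathfrak{c}$ is the cardinality of the continuum, and $\mathbb{T}^{\mathbb{N}}$ is the direct product of countably many copies of $\mathbb{T}$ with the Tychonoff product topology. For a family of groups $\{G_i:i\in I\}$ with direct product $G=\prod_{i\in I}G_i$, $\bigoplus_{i\in I}G_i$ denotes the subgroup of all $g\in G$ such that $g(i)$ is the identity of $G_i$ for all but finitely many $i\in I$. For $J\subseteq I$, $p_{IJ}:\prod_{i\in I}G_i\to\prod_{j\in J}G_j$ is the projection $g\mapsto g\restriction_J$. A subgroup $H$ of $G$ is: controllable in $G$ if $p_{IJ}(H)=p_{IJ}(H\cap\bigoplus_{i\in I}G_i)$ for every finite set $J\subseteq I$; weakly controllable in $G$ (when the $G_i$ are topological groups and $G$ has the Tychonoff product topology) if $H\cap\bigoplus_{i\in I}G_i$ is dense in $H$. *)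

(* Defs.v *)
From HB Require Import structures.
From mathcomp Require Import all_boot all_order all_algebra.
From mathcomp Require Import all_classical all_reals.
From mathcomp Require Import topology normedtype.
From mathcomp Require Import complex.

Set Implicit Arguments.
Unset Strict Implicit.
Unset Printing Implicit Defensive.

Import Order.TTheory GRing.Theory Num.Theory.
Import numFieldTopology.Exports numFieldNormedType.Exports.

Local Open Scope classical_set_scope.
Local Open Scope group_scope.

(* MathComp-Analysis only has additive (hence abelian) topological groups. *)
HB.mixin Record isTopologicalGroup G of Topological G & Group G := {
  mulg_continuous : continuous (fun x : G * G => x.1 * x.2) ;
  invg_continuous : continuous (fun x : G => x^-1) ;
}.

#[short(type="topGroupType")]
HB.structure Definition TopologicalGroup :=
  {G of Topological G & Group G & isTopologicalGroup G}.

Section DirectProduct.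
Variables (I : Type) (G : I -> groupType).
Implicit Types f g h : forall i, G i.

Definition prod_one : forall i, G i := fun=> 1.
Definition prod_inv f : forall i, G i := fun i => (f i)^-1.
Definition prod_mul f g : forall i, G i := fun i => f i * g i.

Fact prod_mulA : associative prod_mul.
Proof. by move=> f g h; apply/functional_extensionality_dep => i; exact: mulgA. Qed.
Fact prod_mul1 : left_id prod_one prod_mul.
Proof. by move=> f; apply/functional_extensionality_dep => i; exact: mul1g. Qed.
Fact prod_mulr1 : right_id prod_one prod_mul.
Proof. by move=> f; apply/functional_extensionality_dep => i; exact: mulg1. Qed.
Fact prod_mulV : left_inverse prod_one prod_inv prod_mul.
Proof. by move=> f; apply/functional_extensionality_dep => i; exact: mulVg. Qed.
Fact prod_mulrV : right_inverse prod_one prod_inv prod_mul.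
Proof. by move=> f; apply/functional_extensionality_dep => i; exact: mulgV. Qed.

HB.instance Definition _ := isGroup.Build (forall i, G i)
  prod_mulA prod_mul1 prod_mulr1 prod_mulV prod_mulrV.

Definition direct_sum : set (forall i, G i) :=
  [set g | finite_set [set i | g i != 1]].

Definition proj_on (J : set I) (g : forall i, G i) : forall j : J, G (\val j) :=
  fun j => g (\val j).

Definition controllable (H : set (forall i, G i)) : Prop :=
  forall J : set I, finite_set J ->
    @proj_on J @` H = @proj_on J @` (H `&` direct_sum).

End DirectProduct.

Arguments direct_sum {I} G _.
Arguments controllable {I G} H.

Definition subgroup (G : groupType) (H : set G) : Prop := group_closed [in H].

(* Here [set_type H] carries the topology induced by the product topology. *)
Definition weakly_controllable (I : Type) (G : I -> topGroupType)
    (H : set (prod_topology G)) : Prop :=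
  dense [set x : set_type H | (H `&` direct_sum G) (\val x)].

(* The circle group, as the group of complex numbers of modulus 1. *)
Record circle (R : realType) := Circle {
  circle_val : R[i] ;
  circleP : (`|circle_val| == 1)%R
}.

HB.instance Definition _ (R : realType) := [isSub for @circle_val R].
HB.instance Definition _ (R : realType) := [Choice of circle R by <:].
HB.instance Definition _ (R : realType) := Topological.copy (circle R)
  (initial_topology (@circle_val R : circle R -> R[i]^o)).

Section Circle.
Variable R : realType.
Implicit Types z w : circle R.

Fact circle_one_subproof : (`|1 : R[i]| == 1)%R.
Proof. by rewrite normr1. Qed.
Fact circle_mul_subproof z w : (`|circle_val z * circle_val w| == 1)%R.
Proof. by rewrite normrM (eqP (circleP z)) (eqP (circleP w)) mulr1. Qed.
Fact circle_inv_subproof z : (`|(circle_val z)^-1| == 1)%R.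
Proof. by rewrite normfV (eqP (circleP z)) invr1. Qed.

Definition circle_one : circle R := Circle circle_one_subproof.
Definition circle_mul z w : circle R := Circle (circle_mul_subproof z w).
Definition circle_inv z : circle R := Circle (circle_inv_subproof z).

Fact circle_neq0 z : (circle_val z != 0)%R.
Proof. by rewrite -normr_eq0 (eqP (circleP z)) oner_eq0. Qed.

Fact circle_mulA : associative circle_mul.
Proof. by move=> x y z; apply/val_inj/mulrA. Qed.
Fact circle_mul1 : left_id circle_one circle_mul.
Proof. by move=> x; apply/val_inj/mul1r. Qed.
Fact circle_mulr1 : right_id circle_one circle_mul.
Proof. by move=> x; apply/val_inj/mulr1. Qed.
Fact circle_mulV : left_inverse circle_one circle_inv circle_mul.
Proof. by move=> x; apply/val_inj/mulVf/circle_neq0. Qed.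
Fact circle_mulrV : right_inverse circle_one circle_inv circle_mul.
Proof. by move=> x; apply/val_inj/mulfV/circle_neq0. Qed.

HB.instance Definition _ := isGroup.Build (circle R)
  circle_mulA circle_mul1 circle_mulr1 circle_mulV circle_mulrV.

Fact circle_val_continuous : continuous (@circle_val R : circle R -> R[i]^o).
Proof. exact: initial_continuous. Qed.

Fact circle_mul_continuous :
  continuous (fun x : circle R * circle R => x.1 * x.2).
Proof.
apply/(@continuous_comp_initial _ _ _ (@circle_val R : circle R -> R[i]^o)) => x.
apply: (@cvgM R[i] _ _ _ (fun x => circle_val x.1) (fun x => circle_val x.2)).
  by apply: continuous_comp; [exact: cvg_fst|exact: circle_val_continuous].
by apply: continuous_comp; [exact: cvg_snd|exact: circle_val_continuous].
Qed.

Fact circle_inv_continuous : continuous (fun x : circle R => x^-1).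
Proof.
apply/(@continuous_comp_initial _ _ _ (@circle_val R : circle R -> R[i]^o)) => x.
apply: (@continuous_comp _ R[i]^o R[i]^o (@circle_val R) (@GRing.inv R[i])).
  exact: circle_val_continuous.
exact: (@inv_continuous R[i] (circle_val x) (circle_neq0 x)).
Qed.

HB.instance Definition _ := isTopologicalGroup.Build (circle R)
  circle_mul_continuous circle_inv_continuous.

End Circle.

Definition circle_family (R : realType) : nat -> topGroupType := fun=> circle R.

(* Main.v *)
Require Import Defs.
From mathcomp Require Import all_boot all_order all_algebra.
From mathcomp Require Import all_classical all_reals.
From mathcomp Require Import topology normedtype complex.
From mathcomp Require Import ring lra.

(** Write [T] for the circle. The family has at most as many members as [T^N]
    has subsets, and [T^N] injects into the reals: a sequence of complex numbers
    is determined by the rational Dedekind cuts of its coordinates, which form a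
    set of naturals ([rational_cuts_inj]), and a set of naturals is determined
    by a real with digits 0 and 1 in base 3 ([ternary_inj]).

    For the lower bound, fix a dense proper subgroup [D] of [T] (the points with
    rational coordinates) and an almost disjoint family [A] of infinite sets of
    naturals, indexed by [option R]. To a nonempty set [S] of indices associate
    [tail_group D A S], the group of the sequences [g] which take one and the
    same value [c] almost everywhere on every [A x], [x] in [S], and whose
    coordinate 0 agrees with [c] modulo [D].
    - It contains every finitely supported [g] with [g 0] in [D]; these are
      dense in [T^N] since [D] is dense in [T], so it is weakly controllable.
    - It contains the constant sequences, so every point of [T] is the
      coordinate 0 of a member. A finitely supported member has [c = 1], hence
      its coordinate 0 lies in [D]. As [D] is proper, the group is not
      controllable.
    - It determines [S]: if [x] is not in [S] and [c] is not in [D], the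
      sequence equal to [c] on [A x] (but 1 at 0) and to 1 elsewhere belongs to
      it, by almost disjointness, but to no [tail_group D A S'] with [x] in [S'].

    Sets of reals are turned into nonempty sets of indices by always including
    the extra index [None]. *)

Set Implicit Arguments.
Unset Strict Implicit.
Unset Printing Implicit Defensive.

Import Order.TTheory GRing.Theory Num.Theory.
Import numFieldTopology.Exports numFieldNormedType.Exports.

Local Open Scope classical_set_scope.
Local Open Scope card_scope.

(** * Coding sequences of complex numbers by reals *)

Section RealCodes.
Variable R : realType.
Local Open Scope ring_scope.
Implicit Types A B : set nat.

Definition ternary_prefix A n : R := \sum_(i < n) (`[< A i >])%:R * 3^-1 ^+ i.

Definition ternary A : R := sup (range (ternary_prefix A)).

Lemma ternary_prefixS A n :
  ternary_prefix A n.+1 = ternary_prefix A n + (`[< A n >])%:R * 3^-1 ^+ n.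
Proof. exact: big_ord_recr. Qed.

(** The upper bound is the tail of the geometric series of ratio 1/3, kept in
    closed form so that the induction on [k] goes through. *)
Lemma ternary_prefix_tail A n k :
  ternary_prefix A n <= ternary_prefix A (n + k)
    <= ternary_prefix A n + 3 / 2 * (3^-1 ^+ n - 3^-1 ^+ (n + k)).
Proof.
elim: k => [|k /andP[IH1 IH2]]; first by rewrite addn0 subrr mulr0 addr0 lexx.
have p0 : 0 < (3^-1 : R) ^+ (n + k) by rewrite exprn_gt0 ?invr_gt0.
rewrite addnS ternary_prefixS exprS.
move: p0 IH1 IH2; move: (3^-1 ^+ (n + k)) => p p0 IH1 IH2.
by case: asboolP => _; rewrite ?mul1r ?mul0r; apply/andP; split; lra.
Qed.

Lemma ternary_bounds A n :
  ternary_prefix A n <= ternary A <= ternary_prefix A n + 3 / 2 * 3^-1 ^+ n.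
Proof.
have ubA : ubound (range (ternary_prefix A))
    (ternary_prefix A n + 3 / 2 * 3^-1 ^+ n).
  move=> _ [m _ <-].
  have p0 k : 0 < (3^-1 : R) ^+ k by rewrite exprn_gt0 ?invr_gt0.
  have [/subnKC <-|/ltnW/subnKC mn] := leqP n m.
    have /andP[_ /le_trans] := ternary_prefix_tail A n (m - n); apply.
    by have := p0 (n + (m - n))%N; lra.
  have /andP[+ _] := ternary_prefix_tail A m (n - m).
  by rewrite mn => /le_trans; apply; have := p0 n; lra.
apply/andP; split.
  by apply: ub_le_sup; [eexists; exact: ubA|exists n].
by apply: ge_sup => //; exists (ternary_prefix A 0), 0%N.
Qed.

(** With digits 0 and 1 in base 3, all the digits after position [k] contribute
    at most half of the digit at [k], so the first difference decides. *)
Lemma ternary_lt A B k :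
  (forall i, (i < k)%N -> A i <-> B i) -> A k -> ~ B k -> ternary B < ternary A.
Proof.
move=> AB Ak nBk.
have eqk : ternary_prefix A k = ternary_prefix B k.
  apply: eq_bigr => i _; congr (_%:R * _); congr nat_of_bool.
  by apply/asbool_equiv_eq/AB.
have p0 : 0 < (3^-1 : R) ^+ k by rewrite exprn_gt0 ?invr_gt0.
have /andP[+ _] := ternary_bounds A k.+1.
have /andP[_] := ternary_bounds B k.+1.
rewrite !ternary_prefixS (asboolT Ak) (asboolF nBk) eqk exprS mul1r mul0r; lra.
Qed.

Lemma ternary_inj : injective ternary.
Proof.
move=> A B eqAB; apply: contrapT => neqAB.
have /ex_minnP[k /asboolP ABk kmin] : exists k, `[< ~ (A k <-> B k) >].
  apply: contrapT => noex; apply: neqAB; apply/predeqP => k.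
  by apply: contrapT => ABk; apply: noex; exists k; apply/asboolP.
have below i : (i < k)%N -> A i <-> B i.
  move=> ik; apply: contrapT => /asboolP /kmin.
  by rewrite leqNgt ik.
have [Ak|nAk] := pselect (A k).
  have nBk : ~ B k by tauto.
  by have := ternary_lt below Ak nBk; rewrite eqAB ltxx.
have Bk : B k by apply: contrapT; tauto.
have below' i : (i < k)%N -> B i <-> A i by move=> /below; tauto.
by have := ternary_lt below' Bk nAk; rewrite eqAB ltxx.
Qed.

Definition rational_cuts (u : nat -> R[i]) : set nat :=
  [set k | exists n b (q : rat), k = pickle (n, b, q) /\
    ratr q < if b then complex.Re (u n) else complex.Im (u n)].

Lemma eq_rational_cuts (x y : R) :
  (forall q : rat, ratr q < x <-> ratr q < y) -> x = y.
Proof.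
move=> xy; apply/eqP; rewrite eq_le !leNgt.
by apply/andP; split; apply/negP => /rat_in_itvoo[q];
  rewrite inE/= => /andP[/ltW + /xy]; rewrite leNgt => /negP.
Qed.

Lemma rational_cuts_inj : injective rational_cuts.
Proof.
move=> u v uv; apply: funext => n.
have cut b q : ratr q < (if b then complex.Re (u n) else complex.Im (u n)) <->
               ratr q < (if b then complex.Re (v n) else complex.Im (v n)).
  have /predeqP/(_ (pickle (n, b, q))) := uv.
  have key w : rational_cuts w (pickle (n, b, q)) <->
    ratr q < (if b then complex.Re (w n) else complex.Im (w n)).
    split=> [[n' [b' [q' [/(pcan_inj pickleK) [-> -> ->]]]]]//|qw].
    by exists n, b, q.
  by move=> uvq; apply: (iff_trans (iff_sym (key u))); apply: (iff_trans uvq).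
apply/eqP; rewrite eq_complex; apply/andP; split; apply/eqP.
  by apply: eq_rational_cuts => q; exact: (cut true).
by apply: eq_rational_cuts => q; exact: (cut false).
Qed.
End RealCodes.

(** * An almost disjoint family of sets of naturals *)

Section AlmostDisjoint.
Variable R : realType.
Local Open Scope ring_scope.

(** The sequence of the integer parts of the multiples [n * r], with [n] recorded
    so that distinct positions have distinct codes; [None] is an additional
    sequence, disjoint from all the others. *)
Definition multiples_code (x : option R) (n : nat) : nat :=
  pickle (n, omap (fun r => Num.floor (n%:R * r)) x).

Lemma multiples_code_inj x : injective (multiples_code x).
Proof. by move=> n m /(pcan_inj pickleK) []. Qed.

Lemma infinite_range_multiples_code x :
  infinite_set (range (multiples_code x)).
Proof.
move=> /(finite_preimage (in2W (@multiples_code_inj x))).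
have -> : multiples_code x @^-1` range (multiples_code x) = setT.
  by apply/seteqP; split=> // n _; exists n.
exact: infinite_nat.
Qed.

(** If [r != s] then [n * r] and [n * s] are more than 1 apart for large [n], so
    their integer parts differ. *)
Lemma multiples_code_almost_disjoint x y : x != y ->
  finite_set (range (multiples_code x) `&` range (multiples_code y)).
Proof.
move=> xy; suff [N codeN] : exists N : nat, forall n, (N <= n)%N ->
    multiples_code x n <> multiples_code y n.
  apply: (@sub_finite_set _ _ (multiples_code x @` `I_N)); last first.
    exact/finite_image/finite_II.
  move=> _ [[n _ <-] [m _ mn]]; exists n => //=; rewrite ltnNge.
  apply/negP => /codeN; apply.
  by move: (mn) => /(pcan_inj pickleK) [mn' _]; rewrite -mn mn'.
case: x y xy => [r|] [s|] //= rs; do ?by exists 0%N => n _ /(pcan_inj pickleK).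
have rs0 : 0 < `|r - s|.
  by rewrite normr_gt0 subr_eq0; apply: contraNneq rs => ->.
exists (Num.bound `|r - s|^-1) => n Nn /(pcan_inj pickleK) [fl].
have n_gt : 1 < n%:R * `|r - s|.
  rewrite -ltr_pdivrMr// div1r.
  by apply: lt_le_trans (archi_boundP _) _; rewrite ?ler_nat ?invr_ge0.
have /andP[r1 r2] := floor_itv (n%:R * r).
have /andP[s1 s2] := floor_itv (n%:R * s).
move: n_gt; rewrite -{1}(ger0_norm (ler0n R n)) -normrM mulrBr.
apply/negP; rewrite -leNgt; apply: ltW; rewrite ltr_norml.
by move: r2 s1 s2; rewrite -fl intrD => *; apply/andP; split; lra.
Qed.
End AlmostDisjoint.

(** * Sequences with a common tail value along prescribed sets *)

Section TailGroup.
Variables (G : topGroupType) (I : Type).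
Local Open Scope group_scope.
Implicit Types (S : set I) (g : nat -> G).

Variables (D : set G) (A : I -> set nat).
Hypothesis mulGC : forall x y : G, x * y = y * x.
Hypothesis D_subgroup : subgroup D.
Hypothesis D_dense : dense D.
Hypothesis A_inf : forall x, infinite_set (A x).
Hypothesis A_ad : forall x y, x <> y -> finite_set (A x `&` A y).

Local Notation GN := (forall n : nat, (fun=> G) n).

Definition tail_group S : set GN :=
  [set g | exists c, D (g 0%N * c^-1) /\
    forall x, S x -> finite_set (A x `&` [set n | g n != c])].

Let D1 : D 1. Proof. by case: D_subgroup => /set_mem. Qed.
Let Ddiv x y : D x -> D y -> D (x * y^-1).
Proof.
by move=> /mem_set Dx /mem_set Dy; apply: set_mem; apply D_subgroup.2.
Qed.

Lemma tail_group_subgroup S : subgroup (tail_group S).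
Proof.
split.
  apply/mem_set; exists 1; split; first by rewrite invg1 mulg1.
  move=> x _; apply: (sub_finite_set _ (@finite_set0 nat)) => n [_ /=].
  by rewrite eqxx.
move=> g h /set_mem[c [Dgc Sgc]] /set_mem[d [Dhd Shd]].
apply/mem_set; exists (c * d^-1); split.
  have -> : (g * h^-1) 0%N * (c * d^-1)^-1 =
      (g 0%N * c^-1) * (h 0%N * d^-1)^-1.
    rewrite !invgM !invgK -[(g * _) 0%N]/(g 0%N * (h 0%N)^-1).
    rewrite -!mulgA; congr (_ * _).
    by rewrite mulGC (mulGC d) mulgA.
  exact: Ddiv.
move=> x Sx; apply: (@sub_finite_set _ _
    ((A x `&` [set n | g n != c]) `|` (A x `&` [set n | h n != d]))).
  move=> n [Axn /=]; rewrite -[(g * h^-1) n]/(g n * (h n)^-1) => neq.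
  have [gc|gc] := eqVneq (g n) c; last by left.
  by right; split=> //=; apply: contra neq => /eqP->; rewrite gc.
by rewrite finite_setU; split; [exact: Sgc|exact: Shd].
Qed.

Lemma tail_unique x g (c d : G) :
  finite_set (A x `&` [set n | g n != c]) ->
  finite_set (A x `&` [set n | g n != d]) -> c = d.
Proof.
move=> fc fd; apply: contrapT => /eqP cd; apply: (@A_inf x).
apply: (@sub_finite_set _ _
    ((A x `&` [set n | g n != c]) `|` (A x `&` [set n | g n != d]))).
  move=> n Axn; have [gc|gc] := eqVneq (g n) c; last by left.
  by right; split=> //=; rewrite gc.
by rewrite finite_setU.
Qed.

(** Since [A x] is infinite, a finitely supported sequence can only have the
    common tail value 1. *)
Lemma tail_group_direct_sum S g : S !=set0 ->
  (tail_group S `&` direct_sum (fun=> G)) g -> D (g 0%N).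
Proof.
move=> [x Sx] [[c [Dgc Sgc]] gfin].
have c1 : c = 1.
  apply: (@tail_unique x g); first exact: Sgc.
  exact: (sub_finite_set _ gfin) => n [].
by move: Dgc; rewrite c1 invg1 mulg1.
Qed.

Lemma direct_sum_tail_group S g :
  direct_sum (fun=> G) g -> D (g 0%N) -> tail_group S g.
Proof.
move=> gfin Dg; exists 1; split; first by rewrite invg1 mulg1.
by move=> x _; apply: (sub_finite_set _ gfin) => n [].
Qed.

Lemma const_tail_group S c : tail_group S (fun=> c).
Proof.
exists c; split; first by rewrite mulgV.
move=> x _; apply: (sub_finite_set _ (@finite_set0 nat)) => n [_ /=].
by rewrite eqxx.
Qed.

(** Already the projection to coordinate 0 tells them apart: constant sequences
    reach all of [G], finitely supported members only [D]. *)
Lemma tail_group_not_controllable S : S !=set0 -> ~` D !=set0 ->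
  ~ controllable (tail_group S).
Proof.
move=> S0 [c nDc] /(_ [set 0%N] (finite_set1 _)).
move=> /predeqP/(_ (proj_on (fun=> c)))[+ _].
case; first by exists (fun=> c) => //; exact: const_tail_group.
move=> h hSum; have m0 : 0%N \in [set 0%N] by apply/mem_set.
move=> /(congr1 (fun f => f (exist _ 0%N m0))).
rewrite /proj_on /= => hc; apply: nDc; rewrite -hc.
exact: tail_group_direct_sum hSum.
Qed.

(** Move coordinate 0 into [D] without leaving the open set, then truncate far
    enough: truncations converge coordinatewise. *)
Lemma direct_sum_dense (O : set (prod_topology (fun=> G : topologicalType))) :
  open O -> O !=set0 ->
  exists g, [/\ O g, direct_sum (fun=> G) g & D (g 0%N)].
Proof.
move=> oO [g Og].
have [z [Oz Dz]] : ((dfwith g 0%N) @^-1` O) `&` D !=set0.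
  apply: D_dense.
    exists (g 0%N); rewrite /preimage /=.
    suff -> : dfwith g 0%N (g 0%N) = g by [].
    by apply: functional_extensionality_dep => i; case: dfwithP.
  by apply: open_comp oO => x _; exact: dfwith_continuous.
set g' := dfwith g 0%N z in Oz.
pose cut n : prod_topology (fun=> G : topologicalType) :=
  fun m => if (m < n.+1)%N then g' m else 1.
have cut_cvg : cut @ \oo --> (g' : prod_topology (fun=> G : topologicalType)).
  apply/cvg_sup => N U [V] [[W] oW <-] WfN WU.
  by apply: (filterS WU); rewrite nbhs_simpl; exists N => // i /=;
    rewrite /cut ltnS => ->.
have [n On] : exists n, O (cut n).
  have /cut_cvg[N _ /(_ N)] : nbhs (g' : prod_topology _) O.
    exact: open_nbhs_nbhs.
  by move=> ON; exists N; apply: ON => /=.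
exists (cut n); split=> //; last by rewrite /cut /= /g' dfwithin.
apply: (@sub_finite_set _ _ `I_n.+1); last exact: finite_II.
by move=> m; rewrite /= /cut; case: ifP => //; rewrite eqxx.
Qed.

Lemma tail_group_weakly_controllable S :
  @weakly_controllable nat (fun=> G) (tail_group S).
Proof.
move=> O [x Ox] [/= V oV VO].
have [|g [Vg gsum Dg]] := @direct_sum_dense V oV.
  by exists (set_val x); move: Ox; rewrite -VO.
have Hg := @direct_sum_tail_group S g gsum Dg.
exists (SigSub (mem_set Hg)); split.
  by rewrite -VO.
by [].
Qed.

Lemma tail_group_subset S S' : ~` D !=set0 ->
  tail_group S `<=` tail_group S' -> S' `<=` S.
Proof.
move=> [c nDc] SS' x S'x; apply: contrapT => nSx.
(* Coordinate 0 is reset to 1 because [A x] may contain 0, whereas the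
   coordinate 0 of a member is constrained by [D]. *)
pose e : GN := fun n => if `[< A x n /\ n <> 0%N >] then c else 1.
have e0 : e 0%N = 1 by rewrite /e asboolF// => -[].
have : tail_group S e.
  exists 1; split; first by rewrite e0 invg1 mulg1.
  move=> y Sy; have yx : y <> x by move=> yx; apply: nSx; rewrite -yx.
  apply: (sub_finite_set _ (A_ad yx)) => n [Ayn /=]; rewrite /e.
  by case: asboolP => [[]//|_]; rewrite eqxx.
move=> /SS' [d []]; rewrite e0 mul1g => Dd /(_ x S'x) ed.
apply: nDc; rewrite (@tail_unique x e c d) //.
  by rewrite -[d]invgK -[_^-1]mul1g; exact: Ddiv.
apply: (sub_finite_set _ (finite_set1 0%N)) => n [Axn /=]; rewrite /e.
by case: asboolP; [rewrite eqxx|move=> nA _; apply: contrapT => n0; exact: nA].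
Qed.
End TailGroup.

(** * Rational points of the circle *)

Section RationalPoints.
Variable R : realType.
Local Open Scope ring_scope.
Local Notation Re := complex.Re.
Local Notation Im := complex.Im.

Definition rational_points : set (circle R) :=
  [set z | rational (Re (circle_val z)) /\ rational (Im (circle_val z))].

Lemma circle_valE (z : circle R) :
  Re (circle_val z) ^+ 2 + Im (circle_val z) ^+ 2 = 1.
Proof.
have := circleP z; rewrite normc_def => /eqP[] /(congr1 (fun x => x ^+ 2)).
by rewrite sqr_sqrtr ?addr_ge0 ?sqr_ge0// expr1n.
Qed.

Lemma circle_point_subproof (x y : R) :
  x ^+ 2 + y ^+ 2 = 1 -> `|Complex x y| == 1.
Proof. by move=> xy; rewrite normc_def /= xy sqrtr1. Qed.

Definition circle_point (x y : R) (xy : x ^+ 2 + y ^+ 2 = 1) : circle R :=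
  Circle (circle_point_subproof xy).

Lemma circle_val_inv (z : circle R) :
  circle_val (z^-1)%g = Complex (Re (circle_val z)) (- Im (circle_val z)).
Proof.
have := circle_valE z; rewrite -[circle_val (z^-1)%g]/((circle_val z)^-1).
by case: (circle_val z) => x y /= xy; rewrite /GRing.inv/= xy !divr1.
Qed.

Lemma rational_add (x y : R) : rational x -> rational y -> rational (x + y).
Proof. by move=> [p _ <-] [q _ <-]; exists (p + q); rewrite // rmorphD. Qed.

Lemma rational_opp (x : R) : rational x -> rational (- x).
Proof. by move=> [p _ <-]; exists (- p); rewrite // rmorphN. Qed.

Lemma rational_mul (x y : R) : rational x -> rational y -> rational (x * y).
Proof. by move=> [p _ <-] [q _ <-]; exists (p * q); rewrite // rmorphM. Qed.

Lemma rational_points_subgroup : subgroup rational_points.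
Proof.
split.
  apply/mem_set; split; first by exists 1; rewrite // rmorph1.
  by exists 0; rewrite // rmorph0.
move=> z w /set_mem[zx zy] /set_mem[wx wy]; apply/mem_set.
suff : rational (Re (circle_val z * circle_val (w^-1)%g)) /\
       rational (Im (circle_val z * circle_val (w^-1)%g)) by [].
rewrite circle_val_inv; move: zx zy wx wy.
case: (circle_val z) => a b; case: (circle_val w) => c d /= *.
by split; do ?[exact: rational_mul|exact: rational_opp|exact: rational_add
  |apply: rational_add|apply: rational_opp|apply: rational_mul].
Qed.

Lemma stereographic_subproof (t : R) :
  ((1 - t ^+ 2) / (1 + t ^+ 2)) ^+ 2 + (t *+ 2 / (1 + t ^+ 2)) ^+ 2 = 1.
Proof.
have : 1 + t ^+ 2 != 0 by rewrite gt_eqF// ltr_pwDl// sqr_ge0.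
by move=> ?; field.
Qed.

Definition stereographic t : circle R := circle_point (stereographic_subproof t).

Lemma continuous_complex (f g : R -> R) : continuous f -> continuous g ->
  continuous (fun t => Complex (f t) (g t) : R[i]^o).
Proof.
move=> cf cg t; apply/(@cvgrPdist_lt R[i] R[i]^o) => /= e e0.
have re0 : 0 < Re e by move: e0; case: e => a b; rewrite ltcE => /andP[].
have eE : e = (Re e)%:C%C.
  by move: e0; case: e {re0} => a b; rewrite ltcE /= => /andP[/eqP -> _].
have re2 : 0 < Re e / 2 by rewrite divr_gt0.
have /cvgrPdist_lt/(_ _ re2) cft := cf t.
have /cvgrPdist_lt/(_ _ re2) cgt := cg t.
near=> s.
have fs : `|f t - f s| < Re e / 2 by near: s.
have gs : `|g t - g s| < Re e / 2 by near: s.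
rewrite eE normc_def ltcR.
rewrite -[ltRHS]ger0_norm ?ltW// -sqrtr_sqr ltr_sqrt ?exprn_gt0//=.
move: fs gs; rewrite !ltr_norml => /andP[? ?] /andP[? ?]; nra.
Unshelve. all: by end_near.
Qed.

Lemma stereographic_continuous : continuous stereographic.
Proof.
apply/(@continuous_comp_initial _ _ _ (@circle_val R : circle R -> R[i]^o)).
have dt t : 1 + t ^+ 2 != 0 :> R by rewrite gt_eqF// ltr_pwDl// sqr_ge0.
have sqr_continuous : continuous (fun t : R => t ^+ 2).
  by move=> t; apply: cvgM; exact: cvg_id.
have cd : continuous (fun t : R => 1 + t ^+ 2).
  by move=> t; apply: cvgD; [exact: cvg_cst|exact: sqr_continuous].
apply: continuous_complex => t.
  apply: cvgM; last by apply: cvgV => //; exact: cd.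
  by apply: cvgB; [exact: cvg_cst|exact: sqr_continuous].
apply: cvgM; last by apply: cvgV => //; exact: cd.
by apply: cvgMn; exact: cvg_id.
Qed.

Lemma stereographic_surj z : circle_val z != -1 ->
  stereographic (Im (circle_val z) / (1 + Re (circle_val z))) = z.
Proof.
move=> z1; apply: val_inj => /=.
move: (circle_valE z) z1; rewrite -[\val z]/(circle_val z).
case: (circle_val z) => x y /= xy; rewrite eq_complex /= negb_and => z1.
have x1 : 1 + x != 0.
  apply: contraTneq z1 => x1; have xN : x = - 1 by lra.
  rewrite negb_or !negbK xN eqxx /= oppr0; move: xy; rewrite xN sqrrN expr1n.
  by move=> /eqP; rewrite addrC eq_sym -subr_eq subrr eq_sym sqrf_eq0.
have y2 : y ^+ 2 = 1 - x ^+ 2 by lra.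
have d0 : 1 + (y / (1 + x)) ^+ 2 != 0 by rewrite gt_eqF// ltr_pwDl// sqr_ge0.
have dE : 1 + (y / (1 + x)) ^+ 2 = 2 / (1 + x).
  rewrite expr_div_n y2; by field.
rewrite dE expr_div_n y2; congr Complex; by field.
Qed.

(** Stereographic projection from -1 is a rational parametrisation, so the density
    of the rationals in the line is carried over to the circle. The missing point
    -1 is itself rational. *)
Lemma rational_points_dense : dense rational_points.
Proof.
move=> O [z Oz] oO.
have [z1|z1] := eqVneq (circle_val z) (-1).
  exists z; split=> //; rewrite /rational_points /= z1 /=.
  split; first by exists (-1); rewrite // rmorphN1.
  by exists 0; rewrite // rmorph0 oppr0.
have [] := @dense_rat R (stereographic @^-1` O).
- exists (Im (circle_val z) / (1 + Re (circle_val z))).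
  by rewrite /preimage /= stereographic_surj.
- by apply: open_comp oO => x _; exact: stereographic_continuous.
move=> t [/= + [q _ qt]]; rewrite -{}qt => Oq; exists (stereographic (ratr q)).
split; first exact: Oq.
split => /=.
  exists ((1 - q ^+ 2) / (1 + q ^+ 2)) => //.
  by rewrite fmorph_div rmorphB rmorphD rmorphXn rmorph1.
exists (q *+ 2 / (1 + q ^+ 2)) => //.
by rewrite fmorph_div rmorphMn rmorphD rmorphXn rmorph1.
Qed.

Lemma sqrt_half_circle : (Num.sqrt 2^-1 : R) ^+ 2 + (Num.sqrt 2^-1) ^+ 2 = 1.
Proof. by rewrite sqr_sqrtr ?invr_ge0// [RHS]splitr div1r. Qed.

(** The point of argument pi/4 has abscissa a square root of 1/2, which is
    irrational: the parities of the exponents of 2 disagree. *)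
Lemma rational_points_proper : ~` rational_points !=set0.
Proof.
exists (circle_point sqrt_half_circle) => -[/= [q _ qE] _].
have /eqP : (ratr (q ^+ 2 *+ 2) : R) = ratr 1.
  rewrite rmorphMn rmorphXn /= qE sqr_sqrtr ?invr_ge0// rmorph1.
  by rewrite mulr2n -[X in X + _]div1r -[X in _ + X]div1r -splitr.
rewrite fmorph_eq => /eqP q2.
have : (numq q ^+ 2 *+ 2 = denq q ^+ 2).
  apply: (@intr_inj rat).
  rewrite rmorphMn !rmorphXn /= numqE -[RHS]mul1r -q2; ring.
move=> /(congr1 absz); rewrite -mulr_natr abszM !abszX /= => nd.
have d0 : (0 < `|denq q|)%N by rewrite absz_gt0 denq_neq0.
have n0 : (0 < `|numq q|)%N.
  case: (`|numq q|)%N nd d0 => // /esym/eqP.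
  by rewrite expn_eq0 => /andP[/eqP ->].
move: nd => /(congr1 (logn 2)).
rewrite lognM ?expn_gt0 ?n0// !lognX (@logn_prime _ 2)//=.
by move=> /(congr1 odd); rewrite oddD !oddM.
Qed.
End RationalPoints.

(** * Counting the subgroups *)

(** The index [None] keeps the set of indices nonempty when [B] is empty. *)
Definition pointed_indices T (B : set T) : set (option T) := None |` Some @` B.

Lemma pointed_indices_Some T (B : set T) r : pointed_indices B (Some r) <-> B r.
Proof. by split=> [[//|[s Bs [<-]]]|Br]; [|right; exists r]. Qed.

Lemma card_sets_circle_sequences (R : realType)
    (F : set (set (forall n : nat, circle_family R n))) :
  F #<= [set: set R].
Proof.
pose code (g : forall n : nat, circle_family R n) : R :=
  ternary R (rational_cuts (fun n => circle_val (g n : circle R))).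
have code_inj : injective code.
  move=> g h /ternary_inj/rational_cuts_inj gh.
  apply: functional_extensionality_dep => n.
  exact/val_inj/(congr1 (@^~ n) gh).
apply/pcard_injP; exists (fun H => code @` H) => H K _ _ HK.
by apply/seteqP; split=> g; rewrite -!(image_inj code_inj) HK.
Qed.

(* [set: R] has the cardinality of the continuum, so [set: set R], the set of
   all subsets of R, has cardinality 2^continuum. *)
Theorem theorem4p3 (R : realType) :
  [set H : set (forall n : nat, circle_family R n) |
    [/\ subgroup H,
        weakly_controllable H
      & ~ controllable H]]
  #= [set: set R].
Proof.
apply/card_eqPle; split; first exact: card_sets_circle_sequences.
have comm (x y : circle R) : (x * y = y * x)%g by apply/val_inj/mulrC.
pose A x := range (@multiples_code R x).
have A_inf x : infinite_set (A x) by exact: infinite_range_multiples_code.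
have A_ad x y : x <> y -> finite_set (A x `&` A y).
  by move=> /eqP; exact: multiples_code_almost_disjoint.
have Dsub := @rational_points_subgroup R.
have Dprop := @rational_points_proper R.
pose H (B : set R) : set (forall n : nat, circle_family R n) :=
  tail_group (@rational_points R) A (pointed_indices B).
apply/pcard_leP/injfunPex; exists H.
  move=> B _; split.
  - exact: tail_group_subgroup comm Dsub _.
  - exact: (tail_group_weakly_controllable (@rational_points_dense R)).
  - by apply: tail_group_not_controllable => //; exists None; left.
have sub B C : H B `<=` H C -> C `<=` B.
  move=> /(tail_group_subset Dsub A_inf A_ad Dprop) CB r.
  by move=> /pointed_indices_Some /CB /pointed_indices_Some.
by move=> B C _ _ BC; apply/seteqP; split; apply: sub; rewrite BC.
Qed.
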